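(* Let $p$ be a prime and let $G$ be a finite $p$-group. If the nilpotency class of $G$ is $c$, then $\exp(\gamma_2(G))$ divides $p^{\lceil \log_p c\rceil-1}\exp(G/Z(G))$.
   Context: $\exp(H)$ denotes the exponent of a finite group $H$, i.e. the least positive integer $e$ with $h^e=1$ for all $h\in H$. $\gamma_2(G)=[G,G]$ is the commutator subgroup of $G$, and $Z(G)$ is the center of $G$. $\lceil\cdot\rceil$ is the ceiling function.
   Formalization: For abelian G (class c = 0 or 1) the exponent ⌈log_p c⌉−1 is undefined or −1 and the claim fails (e.g. G cyclic of order p); there the exponent is taken to be 0. For c ≥ 2 the statement is unchanged. *)

(* Defs.v *)
From mathcomp Require Import prime.

(* [up_log p c] is the least e with c <= p ^ e, that is, the ceiling of
   log_p c for c >= 1.  The predecessor used with it is the truncated one, so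
   that the bound is still an integer, namely exponent (G / 'Z(G)), when G is
   abelian (c <= 1). *)

(* Main.v *)
Require Import Defs.
From mathcomp Require Import all_boot all_fingroup all_solvable.
Local Open Scope group_scope.

(** Write L_i for the i-th term of the lower central series of G and p^n for
    the exponent of G / Z(G).  The theorem is the case k = 1 of the following
    claim: if k >= 1 and c <= k p^e, then L_(k+1) has exponent dividing p^N,
    where N = n + max(e - 1, 0) ([expg_lcnS]).  Allowing every k makes room for
    a descending induction: a multiple j k of k meets the bound c with a smaller
    e, hence L_(jk+1) with a smaller exponent.  If e = 0, then c <= k and
    L_(k+1) is trivial, so let e >= 1.

    The induction step says that t |-> t^(p^N) is multiplicative on suitable
    pairs x, y of L_k, those whose commutator lies in L_(2k+1).  By the
    Hall-Petrescu formula ([hall_petrescu]), x^q y^q and (x y)^q differ by a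
    product of powers c_j^C(q,j) with j >= 2 and c_j in the j-th lower central
    term of <x, y>, hence in L_(jk+1) ([sub_lcn_mul]).  For q = p^N the
    binomial coefficient is divisible by p^(N - v), with v the p-adic
    valuation of j ([dvdn_bin_pexp]).  Either v < e, and the claim for j k and
    e - v >= 1, valid as j >= p^v, kills the factor; or v >= e, and then
    j k >= k p^e >= c, so that already c_j = 1.

    Multiplicativity is used twice.  For g in L_k and h in G, the pair
    g^-1, g^h has product [g, h], while g^q is central, so that
    [g, h]^q = (g^q)^-1 (g^q)^h = 1.  Then for pairs in L_(k+1): the elements
    killed by q form a subgroup, which contains the generators [g, h].

    The Hall-Petrescu formula comes from polynomial sequences in the sense of
    Lazard and Leibman: the sequences whose i-th successive difference takes
    values in L_i form a group under pointwise product ([polyseq_closed]), and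
    each of them has a Newton expansion n |-> prod_j c_j^C(n,j) with c_j in L_j
    ([polyseq_newton]); n |-> x^n y^n is such a sequence. *)

(** * Commutators in the lower central series *)

(** The ratio of two successive values of a commutator of sequences.  On the
    right only commutators that involve an increment u or v remain, which is
    what makes the difference of [~ f, g] one step deeper than [~ f, g]. *)
Lemma commg_mul_mul (gT : finGroupType) (x u y v : gT) :
  [~ x, y]^-1 * [~ x * u, y * v] =
    [~ x * u, v] ^ [~ x, y] * [~ [~ x, y], u * v] * [~ u, y] ^ v.
Proof.
rewrite (commgMJ (x * u) y v) (commMgJ x u y) (conjMg ([~ x, y] ^ u) _ v).
rewrite -conjgM (commgEl [~ x, y]) (conjgE _ [~ x, y]).
move: ([~ x, y] ^ (u * v)) ([~ u, y] ^ v) [~ x, y] [~ x * u, v] => s t r w.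
by rewrite !mulgA mulgK.
Qed.

(** The three subgroup lemma, read in the quotient by M. *)
Lemma sub_three_subgroup (gT : finGroupType) (G H K M : {group gT}) :
    G \subset 'N(M) -> H \subset 'N(M) -> K \subset 'N(M) ->
    [~: G, H, K] \subset M -> [~: H, K, G] \subset M ->
  [~: K, G, H] \subset M.
Proof.
move=> nMG nMH nMK.
have quoR3 (A B C : {group gT}) : A \subset 'N(M) -> B \subset 'N(M) ->
    C \subset 'N(M) -> [~: A, B, C] / M = [~: A / M, B / M, C / M].
  by move=> nMA nMB nMC; rewrite !quotientR // comm_subG.
have quo1 (A B C : {group gT}) : A \subset 'N(M) -> B \subset 'N(M) ->
    C \subset 'N(M) ->
    ([~: A, B, C] \subset M) = ([~: A / M, B / M, C / M] == 1).
  move=> nMA nMB nMC; rewrite -quoR3 // -subG1 quotient_sub1 //.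
  by rewrite comm_subG // comm_subG.
rewrite !quo1 // => /eqP GHK1 /eqP HKG1; apply/eqP.
exact: three_subgroup GHK1 HKG1.
Qed.

(** By induction on i, since L_(i+1) = [L_i, G] and the three subgroup lemma
    trades [L_i, G, L_j] for [G, L_j, L_i] and [L_j, L_i, G]. *)
Lemma comm_lcn (gT : finGroupType) (G : {group gT}) i j :
  [~: 'L_i(G), 'L_j(G)] \subset 'L_(i + j)(G).
Proof.
have nLG m n: 'L_m(G) \subset 'N('L_n(G)).
  exact: subset_trans (lcn_sub m G) (lcn_norm n G).
case: i => [|i]; first by rewrite lcn0 commGC commg_subl lcn_norm.
elim: i j => [|i IHi] [|j].
- by rewrite commg_subl lcn_norm.
- by rewrite lcn1 commGC lcnSn.
- by rewrite addn0 commg_subl lcn_norm.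
rewrite lcnSn; apply: sub_three_subgroup; rewrite ?nLG ?lcn_norm //.
  by rewrite [[~: G, _]]commGC -lcnSn commGC addSnnS IHi.
by rewrite [X in [~: X, G]]commGC !addSn /= lcnSn commSg -?addSn ?IHi.
Qed.

Lemma mem_comm_lcn (gT : finGroupType) (G : {group gT}) i j x y :
  x \in 'L_i(G) -> y \in 'L_j(G) -> [~ x, y] \in 'L_(i + j)(G).
Proof. by move=> Lx Ly; rewrite (subsetP (comm_lcn _ _ _ _)) ?mem_commg. Qed.

(** * Polynomial sequences *)

Definition delta (gT : finGroupType) (f : nat -> gT) n := (f n)^-1 * f n.+1.

(** Polynomial sequences of depth i, with only the first d differences
    constrained.  The truncation at d gives an induction in which the
    commutators of sequences of every depth are available at once. *)
Fixpoint polyseq (gT : finGroupType) (K : {group gT}) d i (f : nat -> gT) :=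
  (forall n, f n \in 'L_i(K)) /\
  (if d is d'.+1 then polyseq gT K d' i.+1 (delta gT f) else True).
Arguments delta {gT}.
Arguments polyseq {gT}.

Section PolynomialSequences.
Variables (gT : finGroupType) (K : {group gT}).
Implicit Types (f g : nat -> gT) (d i j : nat).

Lemma eq_polyseq d i f g : f =1 g -> polyseq K d i f -> polyseq K d i g.
Proof.
elim: d => [|d IHd] /= in i f g *; move=> eq_fg [Lf Pf].
  by split=> // n; rewrite -eq_fg.
split=> [n|]; first by rewrite -eq_fg.
by apply: IHd Pf => n; rewrite /delta !eq_fg.
Qed.

Lemma polyseq_mem d i f n : polyseq K d i f -> f n \in 'L_i(K).
Proof. by case: d => [|d] []. Qed.

Lemma polyseq_delta d i f : polyseq K d.+1 i f -> polyseq K d i.+1 (delta f).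
Proof. by case. Qed.

Lemma polyseqW d i f : polyseq K d.+1 i f -> polyseq K d i f.
Proof.
by elim: d => [|d IHd] /= in i f *; case=> Lf Pf; split=> //; apply: IHd.
Qed.

Lemma polyseq_leq d i j f : i <= j -> polyseq K d j f -> polyseq K d i f.
Proof.
elim: d => [|d IHd] /= in i j f *; move=> le_ij [Lf Pf].
  by split=> // n; apply: subsetP (lcn_sub_leq _ le_ij) _ (Lf n).
split=> [n|]; first exact: subsetP (lcn_sub_leq _ le_ij) _ (Lf n).
by apply: IHd Pf.
Qed.

(** The Lazard-Leibman theorem.  Products, inverses and commutators are treated
    together because the difference of each involves the others:
    delta (f g) = (delta f)^g (delta g), delta (f^-1) = ((delta f)^-1)^(f^-1),
    and f^g = f [~ f, g].  One difference fewer is constrained on the right, so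
    the induction on d applies there. *)
Lemma polyseq_closed d :
  [/\ forall i f g, polyseq K d i f -> polyseq K d i g ->
        polyseq K d i (fun n => f n * g n),
      forall i f, polyseq K d i f -> polyseq K d i (fun n => (f n)^-1)
    & forall i j f g, polyseq K d i f -> polyseq K d j g ->
        polyseq K d (i + j) (fun n => [~ f n, g n])].
Proof.
elim: d => [|d [PM PV PR]].
  split=> [i f g [Lf _] [Lg _] | i f [Lf _] | i j f g [Lf _] [Lg _]];
    split=> // n; [exact: groupM | by rewrite groupV | exact: mem_comm_lcn].
have PJ i j f g : polyseq K d i f -> polyseq K d j g ->
    polyseq K d i (fun n => f n ^ g n).
  move=> Pf Pg; apply: (@eq_polyseq _ _ (fun n => f n * [~ f n, g n])).
    by move=> n; rewrite conjg_mulR.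
  by apply: PM => //; apply: polyseq_leq (leq_addr j i) (PR _ _ _ _ Pf Pg).
split=> [i f g Pf Pg | i f Pf | i j f g Pf Pg].
- split=> [n|].
    by rewrite groupM ?(polyseq_mem _ _ _ n Pf) ?(polyseq_mem _ _ _ n Pg).
  apply: (@eq_polyseq _ _ (fun n => delta f n ^ g n * delta g n)).
    by move=> n; rewrite /delta /conjg !invMg !mulgA mulgK.
  apply: PM (polyseq_delta _ _ _ Pg).
  exact: PJ (polyseq_delta _ _ _ Pf) (polyseqW _ _ _ Pg).
- split=> [n|]; first by rewrite groupV (polyseq_mem _ _ _ n Pf).
  apply: (@eq_polyseq _ _ (fun n => (delta f n)^-1 ^ (f n)^-1)).
    by move=> n; rewrite /delta /conjg !invMg !invgK !mulgA mulgK.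
  apply: PJ (PV _ _ (polyseqW _ _ _ Pf)).
  exact: PV (polyseq_delta _ _ _ Pf).
split=> [n|].
  exact: mem_comm_lcn (polyseq_mem _ _ _ n Pf) (polyseq_mem _ _ _ n Pg).
have [Pf' Pg'] := (polyseq_delta _ _ _ Pf, polyseq_delta _ _ _ Pg).
move/polyseqW: Pf => Pf; move/polyseqW: Pg => Pg.
have Pfg := PR _ _ _ _ Pf Pg.
pose fS n := f n * delta f n.
have PfS: polyseq K d i fS by apply: PM => //; apply: polyseq_leq Pf'.
pose w n := delta f n * delta g n.
have Pw: polyseq K d 1 w.
  by apply: PM; [apply: polyseq_leq Pf' | apply: polyseq_leq Pg'].
apply: (@eq_polyseq _ _ (fun n => [~ fS n, delta g n] ^ [~ f n, g n]
   * [~ [~ f n, g n], w n] * [~ delta f n, g n] ^ delta g n)).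
  move=> n; rewrite /w; set u := delta f n; set v := delta g n.
  have Ef: f n.+1 = f n * u by rewrite /u /delta mulKVg.
  have Eg: g n.+1 = g n * v by rewrite /v /delta mulKVg.
  by rewrite /fS -/u /delta Ef Eg commg_mul_mul.
apply: (PM).
  apply: PM; first by rewrite -addnS; apply: (PJ) (PR _ _ _ _ PfS Pg') Pfg.
  by rewrite -addn1; apply: (PR).
by rewrite -addSn; apply: PJ (PR _ _ _ _ Pf' Pg) Pg'.
Qed.

Lemma polyseqM d i f g : polyseq K d i f -> polyseq K d i g ->
  polyseq K d i (fun n => f n * g n).
Proof. by have [PM _ _] := polyseq_closed d; apply: PM. Qed.

Lemma polyseqV d i f : polyseq K d i f -> polyseq K d i (fun n => (f n)^-1).
Proof. by have [_ PV _] := polyseq_closed d; apply: PV. Qed.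

(** Pascal's rule: the difference of a^C(n,j+1) is a^C(n,j). *)
Lemma polyseq_bin d i j a : a \in 'L_(i + j)(K) ->
  polyseq K d i (fun n => a ^+ 'C(n, j)).
Proof.
have mem_i k l b n: b \in 'L_(k + l)(K) -> b ^+ n \in 'L_k(K).
  by move=> Lb; rewrite groupX // (subsetP (lcn_sub_leq _ (leq_addr l k))).
elim: d => [|d IHd] in i j a *; move=> La.
  by split=> // n; apply: mem_i La.
split=> [n|]; first exact: mem_i La.
case: j => [|j] in La *.
  apply: (@eq_polyseq _ _ (fun n => 1 ^+ 'C(n, 0))); last by apply: IHd.
  by move=> n; rewrite /delta !bin0 mulVg.
apply: (@eq_polyseq _ _ (fun n => a ^+ 'C(n, j))).
  by move=> n; rewrite /delta binS expgD mulKg.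
by apply: IHd; rewrite addSnnS.
Qed.

Lemma polyseq_prod d (c : nat -> gT) m : (forall j, c j \in 'L_j(K)) ->
  polyseq K d 0 (fun n => \prod_(0 <= j < m) c j ^+ 'C(n, j)).
Proof.
move=> Lc; elim: m => [|m IHm].
  apply: (@eq_polyseq _ _ (fun n => 1 ^+ 'C(n, 0))); last exact: polyseq_bin.
  by move=> n; rewrite big_geq // expg1n.
apply: (@eq_polyseq _ _ (fun n =>
    \prod_(0 <= j < m) c j ^+ 'C(n, j) * c m ^+ 'C(n, m))).
  by move=> n; rewrite big_nat_recr.
by apply: polyseqM => //; apply: polyseq_bin.
Qed.

(** If f vanishes before j, then f j is the j-th difference of f at 0. *)
Lemma polyseq_vanish j i f : polyseq K j i f ->
  (forall n, n < j -> f n = 1) -> f j \in 'L_(i + j)(K).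
Proof.
elim: j => [|j IHj] in i f *; first by rewrite addn0 => /polyseq_mem-> .
move=> /polyseq_delta Pf f1.
have ->: f j.+1 = delta f j by rewrite /delta (f1 j) // invg1 mul1g.
rewrite addnS -addSn; apply: IHj => // n ltnj.
by rewrite /delta !f1 ?invg1 ?mulg1 // ltnW.
Qed.

(** Newton interpolation: dividing f by the product that agrees with it before
    m leaves a polynomial sequence h which vanishes before m, so that h m may
    serve as the next coefficient. *)
Lemma polyseq_newton f m : (forall d, polyseq K d 0 f) ->
  exists2 c : nat -> gT, forall j, c j \in 'L_j(K)
    & forall n, n < m -> f n = \prod_(0 <= j < m) c j ^+ 'C(n, j).
Proof.
move=> Pf; elim: m => [|m [c Lc Dc]]; first by exists (fun=> 1).
pose q n := \prod_(0 <= j < m) c j ^+ 'C(n, j).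
pose h n := (q n)^-1 * f n.
have Lh: h m \in 'L_m(K).
  rewrite -[m]add0n; apply: polyseq_vanish.
    by apply: polyseqM => //; apply: polyseqV; apply: polyseq_prod.
  by move=> n lt_nm; rewrite /h (Dc n lt_nm) mulVg.
exists (fun j => if j == m then h m else c j) => [j | n].
  by case: eqP => [->|_].
have Dq: \prod_(0 <= j < m) (if j == m then h m else c j) ^+ 'C(n, j) = q n.
  by apply: eq_big_nat => j /andP[_ ltjm]; rewrite ltn_eqF.
rewrite ltnS leq_eqVlt => n_le_m; rewrite big_nat_recr //= Dq eqxx.
case/predU1P: n_le_m => [->|ltnm]; first by rewrite binn expg1 mulKVg.
by rewrite bin_small // mulg1 Dc.
Qed.

(** The Newton expansion of m |-> x^m y^m, whose coefficients of index 0 and 1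
    are read off at m = 0 and m = 1. *)
Theorem hall_petrescu x y n : x \in K -> y \in K ->
  exists2 c : nat -> gT, forall j, c j \in 'L_j(K)
    & x ^+ n * y ^+ n = (x * y) ^+ n * \prod_(2 <= j < n.+1) c j ^+ 'C(n, j).
Proof.
case: n => [|n] Kx Ky; first by exists (fun=> 1) => //; rewrite big_geq ?mulg1.
have Pexp z d: z \in K -> polyseq K d 0 (fun m => z ^+ m).
  move=> Kz; apply: (@eq_polyseq _ _ (fun m => z ^+ 'C(m, 1))).
    by move=> m; rewrite bin1.
  exact: polyseq_bin.
pose f m := x ^+ m * y ^+ m.
have Pf d: polyseq K d 0 f by apply: polyseqM; apply: Pexp.
have [c Lc Dc] := polyseq_newton _ n.+2 Pf.
have tail1 m: m < 2 -> \prod_(2 <= j < n.+2) c j ^+ 'C(m, j) = 1.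
  move=> lt_m2; rewrite big_nat big1 // => j /andP[le2j _].
  by rewrite bin_small // (leq_trans lt_m2).
have c0: c 0 = 1.
  have:= Dc 0 isT; rewrite big_ltn // big_ltn // tail1 // /f !mulg1.
  by rewrite expg0 expg1.
have c1: c 1%N = x * y.
  have:= Dc 1%N isT; rewrite big_ltn // big_ltn // tail1 // /f.
  by rewrite c0 bin0 bin1 !expg1 mulg1 mul1g.
exists c => //; have:= Dc n.+1 (leqnn _); rewrite /f => ->.
by rewrite big_ltn // big_ltn // c0 c1 expg1n mul1g bin1.
Qed.

End PolynomialSequences.

(** * Powers in the lower central series *)

(** Because j C(p^N, j) = p^N C(p^N - 1, j - 1). *)
Lemma dvdn_bin_pexp p N j : prime p -> 0 < j ->
  p ^ (N - logn p j) %| 'C(p ^ N, j).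
Proof.
move=> p_pr j_gt0; have [le_Nl | lt_lN] := leqP N (logn p j).
  by rewrite (eqP le_Nl) dvd1n.
have [m co_pm Dj] := pfactor_coprime p_pr j_gt0.
rewrite -(@Gauss_dvdr _ m) ?coprimeXl //.
rewrite -(@dvdn_pmul2r (p ^ logn p j)) ?expn_gt0 ?prime_gt0 //.
rewrite -expnD subnK 1?ltnW // mulnAC -Dj.
by case: j j_gt0 {lt_lN Dj} => // j _; rewrite -mul_bin_diag dvdn_mulr.
Qed.

(** The commutator hypothesis gains one step over the weight 2k, and the gain
    persists in the longer commutators, each new entry having weight k. *)
Lemma sub_lcn_mul (gT : finGroupType) (G K : {group gT}) k j :
    K \subset 'L_k(G) -> [~: K, K] \subset 'L_(2 * k).+1(G) -> 1 < j ->
  'L_j(K) \subset 'L_(j * k).+1(G).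
Proof.
move=> sKL sK'L; case: j => [|[|j]] // _; elim: j => [|j IHj] //.
rewrite lcnSn; apply: subset_trans (commgSS IHj sKL) _.
have ->: (j.+3 * k).+1 = (j.+2 * k).+1 + k by rewrite mulSn addnC.
exact: comm_lcn.
Qed.

(** The hypothesis on exponents is exactly what cancels every correction factor
    of the Hall-Petrescu formula in the group generated by x and y. *)
Lemma expgM_lcn (gT : finGroupType) (G : {group gT}) p N k x y :
    prime p ->
    (forall j z, 1 < j -> z \in 'L_(j * k).+1(G) ->
       z ^+ (p ^ (N - logn p j)) = 1) ->
    x \in 'L_k(G) -> y \in 'L_k(G) -> [~ x, y] \in 'L_(2 * k).+1(G) ->
  x ^+ (p ^ N) * y ^+ (p ^ N) = (x * y) ^+ (p ^ N).
Proof.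
move=> p_pr expL Lx Ly Lxy; pose K := <<[set x; y]>>%G.
have sKL: K \subset 'L_k(G) by rewrite gen_subG subUset !sub1set Lx.
have nML: 'L_k(G) \subset 'N('L_(2 * k).+1(G)).
  exact: subset_trans (lcn_sub _ _) (lcn_norm _ _).
have sK'L: [~: K, K] \subset 'L_(2 * k).+1(G).
  have nMx := subsetP nML x Lx; have nMy := subsetP nML y Ly.
  have /cent1P cyx:
      commute (coset 'L_(2 * k).+1(G) x) (coset 'L_(2 * k).+1(G) y).
    by apply/commgP; rewrite -morphR //= coset_id.
  rewrite -quotient_cents2 ?(subset_trans sKL) //= quotient_gen; last first.
    by rewrite -gen_subG (subset_trans sKL).
  rewrite quotientU !quotient_set1 // -abelianE abelian_gen /abelian.
  rewrite centU subUset !subsetI !sub1set !cent_set1.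
  by rewrite !cent1id cyx /= cent1C cyx.
have [Kx Ky]: x \in K /\ y \in K by rewrite !mem_gen ?set21 ?set22.
have [c Lc ->] := hall_petrescu _ K x y (p ^ N) Kx Ky.
rewrite big_nat big1 ?mulg1 // => j /andP[j_gt1 _].
have /dvdnP[m ->] := dvdn_bin_pexp p N j p_pr (ltnW j_gt1).
rewrite mulnC expgM (expL j) ?expg1n //.
exact: subsetP (sub_lcn_mul _ _ _ _ _ sKL sK'L j_gt1) _ (Lc j).
Qed.

(** By induction on c - k, for all e at once, because the passage from k to a
    multiple j k lowers e by the p-adic valuation of j. *)
Lemma expg_lcnS (gT : finGroupType) (G : {group gT}) p n c :
    prime p -> 'L_c.+1(G) = 1 ->
    (forall g, g \in G -> g ^+ (p ^ n) \in 'Z(G)) ->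
  forall e k z, 0 < k -> c <= k * p ^ e -> z \in 'L_k.+1(G) ->
  z ^+ (p ^ (n + e.-1)) = 1.
Proof.
move=> p_pr Lc1 expZ e k; have [m] := ubnP (c - k).
elim: m e k => // m IHm e k /ltnSE-le_ck_m z k_gt0 le_c_kpe.
have triv i t: c <= i -> t \in 'L_i.+1(G) -> t = 1.
  move=> le_ci /(subsetP (lcn_sub_leq G (le_ci : c.+1 <= i.+1))).
  by rewrite Lc1 => /set1P.
have [le_ck | lt_kc] := leqP c k.
  by move/(triv k _ le_ck)->; rewrite expg1n.
set N := n + e.-1.
have expL j t: 1 < j -> t \in 'L_(j * k).+1(G) ->
    t ^+ (p ^ (N - logn p j)) = 1.
  move=> j_gt1 Lt; have [le_el | lt_le] := leqP e (logn p j).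
    rewrite (triv _ t _ Lt) ?expg1n // (leq_trans le_c_kpe) // mulnC.
    rewrite leq_pmul2r // dvdn_leq ?(ltnW j_gt1) //.
    exact: dvdn_trans (dvdn_exp2l p le_el) (pfactor_dvdnn p j).
  (* j p^(e - v) >= p^e, so the claim for j k may be used with e - v *)
  have ->: N - logn p j = n + (e - logn p j).-1.
    rewrite /N; case: e lt_le {le_c_kpe N} => // e le_e.
    by rewrite subSn ?addnBA.
  apply: (IHm _ (j * k)%N _ t _ _ Lt).
  - by apply: leq_trans le_ck_m; rewrite ltn_sub2l // ltn_Pmull.
  - by rewrite muln_gt0 k_gt0 ltnW.
  apply: leq_trans le_c_kpe _; rewrite -{1}(subnK (ltnW lt_le)) expnD.
  rewrite (mulnC j) -mulnA leq_mul2l mulnC leq_mul2r.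
  by rewrite (dvdn_leq (ltnW j_gt1) (pfactor_dvdnn p j)) !orbT.
have exp_comm g h: g \in 'L_k(G) -> h \in G -> [~ g, h] ^+ (p ^ N) = 1.
  move=> Lg Gh; have Gg := subsetP (lcn_sub k G) g Lg.
  have Lgh: [~ g, h] \in 'L_k.+1(G).
    by apply: (subsetP (lcnSnS k G)); apply: mem_commg.
  have LgJ: g ^ h \in 'L_k(G) by rewrite memJ_norm // (subsetP (lcn_norm k G)).
  (* [~ g^-1, g ^ h] = [~ g^-1, [~ g, h]] has weight k + (k + 1) *)
  have LggJ: [~ g^-1, g ^ h] \in 'L_(2 * k).+1(G).
    have /commgP/eqP g'g1: commute g^-1 g by rewrite /commute mulVg mulgV.
    rewrite conjg_mulR commgMJ g'g1 conj1g mulg1 mul2n -addnn -addnS.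
    by rewrite mem_comm_lcn ?groupV.
  rewrite commgEl -(expgM_lcn _ G p N k) ?groupV // -conjXg.
  have /centerP[_ cgN]: g ^+ (p ^ N) \in 'Z(G).
    by rewrite /N expnD expgM groupX ?expZ.
  by rewrite conjgE cgN // mulKg expgVn mulVg.
(* powers by p^N are multiplicative on L_(k+1), whence a subgroup *)
pose H := [set t in 'L_k.+1(G) | t ^+ (p ^ N) == 1].
have gH: group_set H.
  apply/group_setP; split=> [|s t]; first by rewrite inE group1 expg1n eqxx.
  rewrite !inE => /andP[Ls /eqP s1] /andP[Lt /eqP t1].
  have LW := subsetP (lcn_subS k G).
  have Lst: [~ s, t] \in 'L_(2 * k).+1(G).
    by rewrite mul2n -addnn -addnS mem_comm_lcn // LW.
  by rewrite groupM // -(expgM_lcn _ G p N k) ?LW // s1 t1 mulg1 /=.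
suffices /subsetP sLH: 'L_k.+1(G) \subset H.
  by move/sLH; rewrite inE => /andP[_ /eqP].
case: k k_gt0 @H gH exp_comm {le_ck_m le_c_kpe lt_kc expL} => //.
move=> k _ H gH exp_comm; rewrite lcnSn (gen_subG _ (Group gH)).
apply/subsetP=> _ /imset2P[g h Lg Gh ->].
by rewrite inE exp_comm // eqxx andbT lcnSn mem_commg.
Qed.

Theorem theorem3p1 (gT : finGroupType) (G : {group gT}) (p c : nat)
    (p_prime : prime p) (pG : p.-group G) (classG : nil_class G = c) :
  exponent [~: G, G] %| (p ^ (up_log p c).-1 * exponent (G / 'Z(G)))%N.
Proof.
have [n Dn]: {n | exponent (G / 'Z(G)) = (p ^ n)%N}.
  by apply: p_natP; rewrite pnat_exponent; apply: quotient_pgroup.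
have Lc1: 'L_c.+1(G) = 1.
  by apply/(lcn_nil_classP _ (pgroup_nil pG)); rewrite classG.
rewrite Dn -expnD addnC; apply/exponentP=> z.
apply: (expg_lcnS _ G p n c _ _ _ _ 1%N) => // [g Gg|].
  have nZg: g \in 'N('Z(G)) by apply: subsetP Gg; apply: gFnorm.
  apply: coset_idr; rewrite ?groupX // morphX // -Dn.
  by apply: expg_exponent; apply: mem_quotient.
by rewrite mul1n up_logP ?prime_gt1.
Qed.
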